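(* Let $A$ and $M$ be real symmetric invertible matrices of the same dimension with different inertia. Then $M^{-1}A$ has at least one negative real eigenvalue, and thus the stationary iteration $$M x_{k+1} = N x_k + b,\qquad k=0,1,\ldots,\qquad N = M-A,$$ for the linear system $Ax=b$ cannot be contractive.
   Context: The inertia of a real symmetric matrix is the triple (number of positive eigenvalues, number of zero eigenvalues, number of negative eigenvalues), counted with multiplicity. Given an invertible linear system $Ax=b$, one splits $A=M-N$ with $M$ invertible (the splitting matrix or preconditioner) and, from a starting vector $x_0$, solves $Mx_{k+1}=Nx_k+b$ for $k=0,1,\ldots$. This stationary iteration is called contractive if all eigenvalues of $M^{-1}N = I-M^{-1}A$ lie strictly inside the unit disc (equivalently, the sequence $\{x_k\}$ converges to the solution for every $x_0$). *)

(* Defs.v *)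
From mathcomp Require Import all_boot all_order all_algebra.
From mathcomp Require Import polyrcf complex.
From mathcomp Require Import all_classical all_reals all_analysis.

Set Implicit Arguments.
Unset Strict Implicit.
Unset Printing Implicit Defensive.

Import Order.TTheory GRing.Theory Num.Theory.
Import numFieldNormedType.Exports.
Local Open Scope ring_scope.

(* [rootsR p] lists the distinct roots of [p != 0] in [R], so this counts the
   eigenvalues in [R] satisfying [P] with algebraic multiplicity.  For a
   symmetric [A] no eigenvalue is missed, since all of them lie in [R]. *)
Definition count_eigenvalues (R : realType) (n : nat) (A : 'M[R]_n)
    (P : pred R) : nat :=
  (\sum_(x <- rootsR (char_poly A) | P x) mup x (char_poly A))%N.

Definition inertia (R : realType) (n : nat) (A : 'M[R]_n) : nat * nat * nat :=
  (count_eigenvalues A (fun x => 0 < x),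
   count_eigenvalues A (fun x => x == 0),
   count_eigenvalues A (fun x => x < 0)).

Definition stationary_iteration (R : realType) (n : nat) (M N : 'M[R]_n)
    (b : 'cV[R]_n) (x : nat -> 'cV[R]_n) : Prop :=
  forall k, M *m x k.+1 = N *m x k + b.

(* The eigenvalues are the complex ones, hence the embedding into [R[i]]; the
   comparison there says that the (real) modulus is less than 1. *)
Definition contractive (R : realType) (n : nat) (M N : 'M[R]_n) : Prop :=
  forall z : R[i],
    eigenvalue (map_mx (real_complex R) (invmx M *m N)) z -> `|z| < 1.

(* The other usual formulation of contractivity: whatever the starting vector,
   the iterates converge to the solution of [A x = b], where [A = M - N]. *)
Definition convergent_to_solution (R : realType) (n : nat) (M N : 'M[R]_n)
    (b : 'cV[R]_n) : Prop :=
  forall x : nat -> 'cV[R]_n, stationary_iteration M N b x ->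
    (x @ \oo --> invmx (M - N) *m b)%classic.

(* Main.v *)
Require Import Defs.
From mathcomp Require Import all_boot all_order all_algebra.
From mathcomp Require Import polyrcf complex.
From mathcomp Require Import ring lra.
From mathcomp Require Import all_classical all_reals all_analysis.

Set Implicit Arguments.
Unset Strict Implicit.
Unset Printing Implicit Defensive.

Import Order.TTheory GRing.Theory Num.Theory.
Import numFieldNormedType.Exports.
Local Open Scope ring_scope.

(** If [B = M^-1 A] has no eigenvalue in [(-oo, 0]], then ['X] is a square modulo
    the characteristic polynomial of [B], so [B = S^2] with [S = q(B)] for a real
    polynomial [q].  As [M B = A = B^T M], also [M S = S^T M], whence
    [A = M S^2 = S^T M S] is congruent to [M] and Sylvester's law of inertia makes
    the inertias agree.  A negative eigenvalue [lambda] of [B] is an eigenvalue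
    [1 - lambda > 1] of [M^-1 N], and the iterates started from the solution plus
    an eigenvector [v] are the solution plus [(1 - lambda)^k v]. *)

(* [ev] is the evaluation at a root [z] of the irreducible [g].  Replacing [q] by
   [q + f * r] leaves a quadratic equation for [r(z)], with discriminant [4 z]
   when [f(z) != 0]. *)
Lemma sqr_modX_lift (F : fieldType) (K : numFieldType)
    (ev : {rmorphism {poly F} -> K}) (g : {poly F}) (s : K)
    (ker_ev : forall p, ev p = 0 -> g %| p) (ev_surj : forall w, exists p, ev p = w)
    (sqr_s : s ^+ 2 = ev 'X) (s_neq0 : s != 0) (f q : {poly F}) :
  f %| q ^+ 2 - 'X -> exists q', g * f %| q' ^+ 2 - 'X.
Proof.
move=> /dvdpP[h qfh].
have evqfh : ev q ^+ 2 - s ^+ 2 = ev h * ev f.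
  by rewrite sqr_s -rmorphXn -rmorphB qfh rmorphM.
have [rho rhoP] : exists rho, ev f * rho ^+ 2 + 2 * ev q * rho + ev h = 0.
  (* If [ev f = 0] the equation is linear, and [ev q] is nonzero because its square is [s ^+ 2]. *)
  have [f0|f_neq0] := eqVneq (ev f) 0.
    have q_neq0 : ev q != 0.
      apply: contra_neq s_neq0 => q0; apply/eqP; rewrite -sqrf_eq0 -oppr_eq0.
      by move: evqfh; rewrite q0 f0 mulr0 expr0n /= sub0r => ->.
    by exists (- ev h / (2 * ev q)); rewrite f0; field.
  exists ((s - ev q) / ev f); apply: (mulfI f_neq0).
  rewrite mulr0 [LHS](_ : _ = s ^+ 2 - ev q ^+ 2 + ev h * ev f); last by field.
  by rewrite -evqfh addrC subrKA subrr.
have [r rE] := ev_surj rho.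
exists (q + f * r).
have -> : (q + f * r) ^+ 2 - 'X = (f * r ^+ 2 + 2%:R * q * r + h) * f.
  have -> : 'X = q ^+ 2 - h * f by rewrite -qfh opprB addrCA subrr addr0.
  by ring.
apply: dvdp_mul => //; apply: ker_ev.
rewrite -[RHS]rhoP -rE -rmorphXn -(rmorph_nat ev 2) -!rmorphM -!rmorphD.
by [].
Qed.

(** * Square roots of ['X] modulo a real polynomial *)

Section RealPoly.
Variable R : rcfType.
Implicit Types (f g p q r : {poly R}) (z w : R[i]).

Let toC := map_poly (real_complex R).

(** The quadratic has roots [a + bi] and [a - bi]. The remainder of [p] is a real affine polynomial
    vanishing at a nonreal point, hence zero. *)
Lemma root_nonreal_dvdp (a b : R) p : b != 0 ->
  (toC p).[Complex a b] = 0 -> ('X - a%:P) ^+ 2 + (b ^+ 2)%:P %| p.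
Proof.
move=> b_neq0 pz0; set g := _ + _.
have sg : size g = 3%N.
  by rewrite size_polyDl size_exp_XsubC // size_polyC; case: eqP.
have g0 : (toC g).[Complex a b] = 0.
  rewrite /toC rmorphD rmorphXn rmorphB /= map_polyX !map_polyC !hornerE /=.
  rewrite -[Complex a b - _]/(Complex (a - a) (b - 0)); apply/eqP.
  by rewrite expr2 eq_complex /=; apply/andP; split; apply/eqP; ring.
rewrite /dvdp; set r := p %% g.
have sr : (size r <= 2)%N by rewrite -ltnS -sg ltn_modp -size_poly_eq0 sg.
have rC : (toC r).[Complex a b] = 0.
  have := pz0; rewrite [p in LHS](divp_eq p g) /toC rmorphD rmorphM !hornerE /=.
  by rewrite -/toC g0 mulr0 add0r.
have rE : r = r`_1 *: 'X + (r`_0)%:P.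
  apply/polyP => i; rewrite coefD coefZ coefX coefC.
  case: i => [|[|i]] /=; rewrite ?mulr0 ?mulr1 ?addr0 ?add0r //.
  by rewrite nth_default // (leq_trans sr).
move: rC; rewrite rE /toC rmorphD /= map_polyZ map_polyX map_polyC !hornerE /=.
move=> /eqP; rewrite eq_complex /= => /andP[/eqP re0 /eqP im0].
have r1 : r`_1 = 0 by apply: (mulIf b_neq0); lra.
by move: re0; rewrite r1 !mul0r subr0 add0r => ->; rewrite scale0r addr0.
Qed.

(** As [b != 0], the numbers 1 and [a + bi] span the complex plane over [R], so affine polynomials
    suffice. *)
Lemma horner_nonreal_surj (a b : R) w : b != 0 ->
  exists r, (toC r).[Complex a b] = w.
Proof.
move=> b_neq0; case: w => u v.
exists ((v / b) *: ('X - a%:P) + u%:P).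
rewrite /toC rmorphD /= map_polyZ rmorphB /= map_polyX !map_polyC !hornerE /=.
apply/eqP; rewrite eq_complex /=; apply/andP; split; apply/eqP; field => //.
Qed.

(** Induction on the size: one irreducible factor, ['X - a] with [a > 0] or a real quadratic, is
    split off and restored by [sqr_modX_lift]. That lift assumes no coprimality, so repeated factors
    are covered. *)
Lemma sqr_modX_exists f :
  (forall x : R, root f x -> 0 < x) -> f != 0 -> exists q, f %| q ^+ 2 - 'X.
Proof.
have [n] := ubnP (size f); elim: n f => // n IHn f sf f_pos f_neq0.
have [sf1|sf1] := leqP (size f) 1.
  exists 0; rewrite (eqp_dvdl _ (_ : f %= 1)) ?dvd1p // -size_poly_eq1.
  by rewrite eqn_leq sf1 size_poly_gt0.
have [[a b] /rootP zP] : exists z, root (toC f) z.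
  apply/closed_rootP; rewrite size_map_poly; by apply: contraTneq sf1 => ->.
have step g f1 : f = g * f1 -> (1 < size g)%N -> exists q, f1 %| q ^+ 2 - 'X.
  move=> fE sg; move: f_neq0; rewrite fE mulf_eq0 negb_or => /andP[g0 f10].
  apply: IHn => [|x fx|//]; last by apply: f_pos; rewrite fE rootM fx orbT.
  move: sf; rewrite fE size_mul // ltnS; apply: leq_trans.
  by case: (size g) sg => [|[|k]] // _; rewrite !addSn /= ltnS leq_addl.
have [b0|b_neq0] := eqVneq b 0.
  have fa : root f a.
    by move: zP; rewrite b0 -[Complex a 0]/(real_complex R a) horner_map => /complexI/rootP.
  have a_gt0 := f_pos _ fa.
  have [f1 fE] := factor_theorem f a fa; rewrite mulrC in fE.
  have [|q qP] := step _ _ fE; first by rewrite size_XsubC.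
  rewrite fE; apply: (@sqr_modX_lift _ _ (horner_eval a) _ (Num.sqrt a)) qP.
  - by move=> p /rootP; rewrite dvdp_XsubCl.
  - by move=> w; exists w%:P; exact: hornerC.
  - by rewrite sqr_sqrtr ?ltW //; apply/esym/hornerX.
  - by rewrite sqrtr_eq0 -ltNge.
set g := ('X - a%:P) ^+ 2 + (b ^+ 2)%:P.
have sg : size g = 3%N.
  by rewrite size_polyDl size_exp_XsubC // size_polyC; case: eqP.
have /dvdpP[f1] := root_nonreal_dvdp b_neq0 zP; rewrite mulrC => fE.
have [|q qP] := step _ _ fE; first by rewrite sg.
rewrite fE.
apply: (@sqr_modX_lift _ _ (horner_eval (Complex a b) \o toC) _ (sqrtc (Complex a b))) qP.
- by move=> p /(root_nonreal_dvdp b_neq0).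
- by move=> w; apply: horner_nonreal_surj.
- by rewrite sqr_sqrtc /= /toC map_polyX /horner_eval hornerX.
- by rewrite sqrtc_eq0 eq_complex negb_and /= b_neq0 orbT.
Qed.
End RealPoly.

(** Intertwining relations are stable under sums and products. The case [C = B^T] will give
    [M S = S^T M]. *)
Lemma horner_mx_intertwine (R : comNzRingType) n (M B C : 'M[R]_n.+1) (p : {poly R}) :
  M *m B = C *m M -> M *m horner_mx B p = horner_mx C p *m M.
Proof.
move=> MB; elim/poly_ind: p => [|p c IHp]; first by rewrite !rmorph0 mulmx0 mul0mx.
rewrite !rmorphD !rmorphM /= !horner_mx_X !horner_mx_C mulmxDr mulmxDl scalar_mxC.
by rewrite mulmxA IHp -!mulmxA MB.
Qed.

Lemma tr_horner_mx (R : comNzRingType) n (B : 'M[R]_n.+1) (p : {poly R}) :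
  (horner_mx B p)^T = horner_mx B^T p.
Proof.
elim/poly_ind: p => [|p c IHp]; first by rewrite !rmorph0 trmx0.
rewrite !rmorphD !rmorphM /= !horner_mx_X !horner_mx_C linearD /= tr_scalar_mx.
rewrite trmx_mul IHp; congr (_ + _).
exact: (horner_mx_intertwine p (erefl (B^T *m B^T))).
Qed.

(** * Signs of congruent diagonal forms *)

Lemma mul_diag_form (C : comNzRingType) n (v d : 'rV[C]_n) (w : 'cV[C]_n):
  (v *m diag_mx d *m w) 0 0 = \sum_i d 0 i * (v 0 i * w i 0).
Proof.
rewrite mul_mx_diag mxE; apply: eq_bigr => i _; rewrite !mxE.
by rewrite mulrA [d 0 i * _]mulrC.
Qed.

(* A vector supported on the positive entries of [d] whose image vanishes on
   the positive entries of [e] exists as soon as there are fewer of the latter,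
   and the two sides of the congruence then have opposite signs at it. *)
Lemma leq_pos_diag_congr (C : numClosedFieldType) n (d e : 'rV[C]_n) (T : 'M[C]_n) :
  (forall i, e 0 i \is Num.real) ->
  diag_mx d = T *m diag_mx e *m map_mx Num.conj T^T ->
  (#|[set i : 'I_n | 0 < d 0 i]%R| <= #|[set i : 'I_n | 0 < e 0 i]%R|)%N.
Proof.
move=> e_real dE; rewrite leqNgt; apply/negP => lt_ed.
pose D := [set i : 'I_n | ~~ (0 < d 0 i)]; pose E := [set i : 'I_n | 0 < e 0 i].
(* [v *m K = 0] says that [v] vanishes on [D] and [v *m T] on [E]. By [lt_ed], [K] has fewer than
   [n] columns, so such a nonzero [v] exists. *)
pose K : 'M[C]_(n, #|D| + #|E|) :=
  row_mx (\matrix_(i, j) (i == enum_val j)%:R) (\matrix_(i, j) T i (enum_val j)).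
have : ~~ row_free K.
  apply/negP => /eqP rK; have := rank_leq_col K; rewrite rK leqNgt => /negP; apply.
  rewrite -[X in (_ < X)%N](card_ord n) -(cardsC [set i : 'I_n | 0 < d 0 i]).
  rewrite [X in (_ < X)%N]addnC.
  suff -> : #|D| = #|~: [set i : 'I_n | (0 < d 0 i)%R]| by rewrite ltn_add2l.
  by apply: eq_card => i; rewrite !inE.
rewrite -kermx_eq0 => /rowV0Pn[v /sub_kermxP vK v_neq0].
move: vK; rewrite mul_mx_row -[0 in RHS]row_mx0 => /eq_row_mx[vD vE].
have v0 i : ~~ (0 < d 0 i) -> v 0 i = 0.
  move=> di; have iD : i \in D by rewrite inE.
  have /rowP/(_ (enum_rank_in iD i)) := vD.
  rewrite !mxE (bigD1 i) //= mxE enum_rankK_in // eqxx mulr1 big1 ?addr0 // => j ij.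
  by rewrite mxE enum_rankK_in // (negPf ij) mulr0.
have vT0 i : 0 < e 0 i -> (v *m T) 0 i = 0.
  move=> ei; have iE : i \in E by rewrite inE.
  have /rowP/(_ (enum_rank_in iE i)) := vE.
  by rewrite !mxE => {2}<-; apply: eq_bigr => j _; rewrite mxE enum_rankK_in.
have : (v *m diag_mx d *m map_mx Num.conj v^T) 0 0 > 0.
  rewrite mul_diag_form.
  have term i : 0 <= d 0 i * (v 0 i * map_mx Num.conj v^T i 0).
    rewrite !mxE; have [di|/v0->] := boolP (0 < d 0 i); last by rewrite mul0r mulr0.
    by rewrite mulr_ge0 ?mul_conjC_ge0 // ltW.
  rewrite lt_neqAle sumr_ge0 // andbT eq_sym; apply: contra v_neq0 => sum0.
  apply/eqP/rowP => i; rewrite mxE.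
  have [di|/v0//] := boolP (0 < d 0 i).
  move: sum0; rewrite psumr_eq0 // => /allP/(_ i); rewrite mem_index_enum => /(_ isT).
  by rewrite !mxE mulf_eq0 mul_conjC_eq0 gt_eqF //= => /eqP.
have -> : v *m diag_mx d *m map_mx Num.conj v^T =
    v *m T *m diag_mx e *m map_mx Num.conj (v *m T)^T.
  by rewrite dE trmx_mul map_mxM !mulmxA.
rewrite mul_diag_form le_gtF // -oppr_ge0 -sumrN sumr_ge0 // => i _.
rewrite -mulNr; have [ei|] := boolP (0 < e 0 i).
  by rewrite vT0 // mul0r mulr0.
rewrite -real_leNgt // => ei.
by rewrite mxE mulr_ge0 ?oppr_ge0 // !mxE mul_conjC_ge0.
Qed.

Lemma card_pos_diag_congr (C : numClosedFieldType) n (d e : 'rV[C]_n) (T : 'M[C]_n) :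
  (forall i, d 0 i \is Num.real) -> (forall i, e 0 i \is Num.real) ->
  T \in unitmx -> diag_mx d = T *m diag_mx e *m map_mx Num.conj T^T ->
  #|[set i : 'I_n | 0 < d 0 i]%R| = #|[set i : 'I_n | 0 < e 0 i]%R|.
Proof.
move=> d_real e_real uT dE; apply/eqP; rewrite eqn_leq (leq_pos_diag_congr _ dE) //=.
apply: (@leq_pos_diag_congr _ _ e d (invmx T)) => //.
rewrite dE !mulmxA mulVmx // mul1mx -mulmxA -map_mxM -trmx_mul mulVmx //.
by rewrite trmx1 map_mx1 mulmx1.
Qed.

(** Carries a congruence of [A] and [M] over to their diagonal forms, by cancelling [U] and its
    adjoint. *)
Lemma diag_congr (C : numClosedFieldType) n (d e : 'rV[C]_n) (U V S A M : 'M[C]_n) :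
  U \in unitmx ->
  A = U *m diag_mx d *m map_mx Num.conj U^T ->
  M = V *m diag_mx e *m map_mx Num.conj V^T ->
  A = map_mx Num.conj S^T *m M *m S ->
  let T := invmx U *m map_mx Num.conj S^T *m V in
  diag_mx d = T *m diag_mx e *m map_mx Num.conj T^T.
Proof.
move=> uU AU MV AE T.
have uU' : map_mx Num.conj U^T \in unitmx by rewrite map_unitmx unitmx_tr.
have TE : map_mx Num.conj T^T = map_mx Num.conj V^T *m S *m invmx (map_mx Num.conj U^T).
  rewrite /T !trmx_mul !map_mxM mulmxA trmx_inv map_invmx.
  congr (_ *m _ *m _); apply/matrixP => i j; rewrite !mxE; exact: conjCK.
apply: (can_inj (mulKmx uU)); apply: (can_inj (mulmxK uU')).
rewrite -AU AE MV TE !mulmxA mulmxV // mul1mx.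
by rewrite -[RHS]mulmxA mulVmx // mulmx1.
Qed.

(** Meant for [s] the distinct roots and [t] the eigenvalues listed with repetition. *)
Lemma sum_count_mem (T : eqType) (P : pred T) (s t : seq T) :
  uniq s -> {subset t <= s} -> (\sum_(x <- s | P x) count_mem x t = count P t)%N.
Proof.
move=> us; elim: t => [|y t IHt] ts /=; first by rewrite big1.
rewrite big_split /= IHt => [|x xt]; last by rewrite ts // inE xt orbT.
congr (_ + _)%N; rewrite big_mkcond (bigD1_seq y) ?ts ?mem_head //= eqxx.
by rewrite big1 => [|x /negPf xy]; rewrite ?addn0 ?[y == x]eq_sym ?xy; case: (P _).
Qed.

Lemma char_poly_similar (F : fieldType) n (P D : 'M[F]_n) :
  P \in unitmx -> char_poly (invmx P *m D *m P) = char_poly D.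
Proof.
move=> uP; have uP' : map_mx polyC P \in unitmx by rewrite map_unitmx.
rewrite /char_poly (_ : char_poly_mx _ =
  invmx (map_mx polyC P) *m char_poly_mx D *m map_mx polyC P).
  by rewrite !det_mulmx mulrAC -det_mulmx mulVmx // det1 mul1r.
rewrite /char_poly_mx mulmxBr mulmxBl !map_mxM map_invmx; congr (_ - _).
by rewrite -mulmxA -scalar_mxC mulmxA mulVmx // mul1mx.
Qed.

(** * Spectral theorem and inertia of real symmetric matrices *)

Section Spectral.
Variables (R : realType) (n : nat).
Implicit Types A M : 'M[R]_n.

Lemma sym_spectral A : A^T = A ->
  exists d : 'I_n -> R, exists2 U : 'M[R[i]]_n, U \in unitmx &
    map_mx (real_complex R) A =
      U *m diag_mx (\row_i real_complex R (d i)) *m map_mx Num.conj U^T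
    /\ char_poly A = \prod_i ('X - (d i)%:P).
Proof.
move=> Asym; pose AC := map_mx (real_complex R) A.
have ACreal : AC \is a mxOver Num.real.
  by apply/mxOverP => i j; rewrite mxE complex_real.
have ACherm : AC \is hermsymmx.
  apply: realsym_hermsym => //; rewrite is_hermitianmxE expr0 scale1r map_mx_id //.
  by rewrite /AC map_trmx Asym.
have dreal := hermitian_spectral_diag_real ACherm.
have /orthomx_spectralP ACE := hermitian_normalmx ACherm.
have U_unitary := spectral_unitarymx AC.
move: dreal ACE U_unitary; set d := spectral_diag AC; set P := spectralmx AC.
move=> /mxOverP dreal ACE PU.
have dE : \row_i real_complex R (complex.Re (d 0 i)) = d.
  by apply/rowP => i; rewrite mxE RRe_real.
exists (fun i => complex.Re (d 0 i)); exists (invmx P).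
  by rewrite unitmx_inv unitarymx_unit.
rewrite dE; split.
  rewrite -/AC {1}ACE; congr (_ *m _).
  by rewrite invmx_unitary // map_trmx -map_mx_comp map_mx_id ?trmxK // => x; exact: conjCK.
(* The factorisation is checked over [R[i]], where [A] is similar to a diagonal matrix with real
   entries, and descends by injectivity of the embedding. *)
apply: (map_poly_inj (real_complex R)).
rewrite map_char_poly -/AC ACE char_poly_similar ?unitarymx_unit //.
rewrite char_poly_trig ?diag_mx_is_trig // rmorph_prod; apply: eq_bigr => i _.
by rewrite rmorphB /= map_polyX map_polyC /= RRe_real // !mxE eqxx.
Qed.

Lemma count_eigenvalues_prod A (d : 'I_n -> R) (P : pred R) :
  char_poly A = \prod_i ('X - (d i)%:P) ->
  count_eigenvalues A P = #|[set i | P (d i)]|.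
Proof.
move=> Ad; rewrite /count_eigenvalues.
have -> : char_poly A = \prod_(y <- codom d) ('X - y%:P).
  by rewrite Ad big_map big_enum.
set p := \prod_(y <- _) _.
have p_neq0 : p != 0 by rewrite monic_neq0 // monic_prod_XsubC.
under eq_bigr do rewrite mu_prod_XsubC.
rewrite sum_count_mem ?uniq_roots // => [|x xd].
  rewrite count_map -sum1_count big_enum_cond -sum1_card.
  by apply: eq_bigl => i; rewrite inE.
by rewrite -(roots_on_rootsR p_neq0) /= root_prod_XsubC.
Qed.

(** Makes the zero count of the inertia follow from the other two. *)
Lemma card_eq0_ord (f : 'I_n -> R) :
  #|[set i | f i == 0]| = (n - (#|[set i | (0 < f i)%R]| + #|[set i | (f i < 0)%R]|))%N.
Proof.
have disj : [disjoint [set i | 0 < f i] & [set i | f i < 0]].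
  rewrite -setI_eq0; apply/eqP/setP => i; rewrite !inE.
  by case: ltgtP.
rewrite -[n in (n - _)%N]card_ord -(cardsC [set i | f i == 0]).
suff <- : [set i | 0 < f i] :|: [set i | f i < 0] = ~: [set i | f i == 0].
  by move: disj; rewrite -leq_card_setU => /eqP ->; rewrite addnK.
by apply/setP => i; rewrite !inE; case: ltgtP.
Qed.

(* Sylvester's law of inertia *)
Lemma inertia_congr A M (S : 'M[R]_n) : A^T = A -> M^T = M ->
  S \in unitmx -> A = S^T *m M *m S -> inertia A = inertia M.
Proof.
move=> Asym Msym uS AE.
have [d [U uU [AU Ad]]] := sym_spectral Asym.
have [e [V uV [MV Me]]] := sym_spectral Msym.
pose SC := map_mx (real_complex R) S.
pose T := invmx U *m map_mx Num.conj SC^T *m V.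
have uT : T \in unitmx.
  by rewrite !unitmx_mul unitmx_inv uU uV map_unitmx unitmx_tr map_unitmx uS.
pose D (f : 'I_n -> R) : 'rV_n := \row_i real_complex R (f i).
have Dreal f i : D f 0 i \is Num.real by rewrite mxE complex_real.
(* Since [S] is real, [S^T] is also its adjoint, as [diag_congr] requires. *)
have SCreal : map_mx Num.conj SC = SC.
  by apply: realmxC; apply/mxOverP => i j; rewrite mxE complex_real.
have DE : diag_mx (D d) = T *m diag_mx (D e) *m map_mx Num.conj T^T.
  apply: (diag_congr uU AU MV).
  by rewrite -map_trmx SCreal AE !map_mxM map_trmx.
have pos f : #|[set i | 0 < D f 0 i]%R| = #|[set i | 0 < f i]|.
  by apply: eq_card => i; rewrite !inE mxE ltcR.
have DN f : D (\- f) = - D f by apply/rowP => i; rewrite !mxE rmorphN.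
have posE : #|[set i | 0 < d i]| = #|[set i | 0 < e i]|.
  by rewrite -!pos; apply: card_pos_diag_congr uT DE.
(* Negative entries are the positive ones of [- d] and [- e], which are congruent through the same
   [T]. *)
have negE : #|[set i | d i < 0]| = #|[set i | e i < 0]|.
  have neg (f : 'I_n -> R) : #|[set i | f i < 0]| = #|[set i | 0 < (\- f) i]|.
    by apply: eq_card => i; rewrite !inE -oppr_gt0.
  rewrite !neg -!pos; apply: (card_pos_diag_congr _ _ uT) => //.
  have diagN (v : 'rV[R[i]]_n) : diag_mx (- v) = - diag_mx v by rewrite linearN.
  by rewrite !DN !diagN DE mulmxN mulNmx.
rewrite /inertia !(count_eigenvalues_prod _ Ad) !(count_eigenvalues_prod _ Me).
by rewrite posE negE !card_eq0_ord posE negE.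
Qed.
End Spectral.

(** * Equal inertia from a square root of [M^-1 A] *)

Lemma inertia_eq_no_neg_eigenvalue (R : realType) n (A M : 'M[R]_n) :
  A^T = A -> M^T = M -> A \in unitmx -> M \in unitmx ->
  (forall x : R, x < 0 -> ~~ eigenvalue (invmx M *m A) x) ->
  inertia A = inertia M.
Proof.
case: n A M => [A M _ _ _ _ _|n A M Asym Msym uA uM noneg].
  by rewrite [A]flatmx0 [M]flatmx0.
set B := invmx M *m A in noneg.
have uB : B \in unitmx by rewrite unitmx_mul unitmx_inv uM.
have MB : M *m B = A by rewrite mulmxA mulmxV // mul1mx.
(* Zero is excluded by invertibility of [B], negative roots by [noneg]. *)
have pos x : root (char_poly B) x -> 0 < x.
  rewrite -eigenvalue_root_char => Bx; rewrite lt_neqAle; apply/andP; split.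
    apply: contraTneq Bx => <-; apply/negP => /eigenvalueP[v vB /eqP[]].
    by rewrite scale0r in vB; rewrite -[v](mulmxK uB) vB mul0mx.
  by rewrite leNgt; apply: contraL Bx; apply: noneg.
have [q qP] := sqr_modX_exists pos (monic_neq0 (char_poly_monic B)).
pose S := horner_mx B q.
(* By Cayley-Hamilton, the multiple [q ^+ 2 - 'X] of the characteristic polynomial vanishes at
   [B]. *)
have SS : S *m S = B.
  have /dvdpP[h hE] := qP.
  have /eqP := congr1 (horner_mx B) hE.
  rewrite rmorphM /= Cayley_Hamilton mulr0 rmorphB rmorphXn /= horner_mx_X.
  by rewrite subr_eq0 => /eqP.
have MS : M *m S = S^T *m M.
  rewrite tr_horner_mx; apply: horner_mx_intertwine.
  by rewrite -{2}Msym -trmx_mul MB.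
apply: (@inertia_congr _ _ _ _ S) => //.
  by move: uB; rewrite -SS unitmx_mul => /andP[].
by rewrite -MS -mulmxA SS MB.
Qed.

(** * Divergence of the iteration *)

(** [eigenvalue] refers to row vectors, whereas the iteration acts on columns; transposing supplies
    a column eigenvector. *)
Lemma eigenvalue_tr (F : fieldType) n (B : 'M[F]_n) a :
  eigenvalue B^T a = eigenvalue B a.
Proof.
rewrite !eigenvalue_root_char /char_poly -det_tr; congr (root (\det _) _).
by rewrite /char_poly_mx linearB /= tr_scalar_mx map_trmx trmxK.
Qed.

Lemma eigenvalue1B (F : fieldType) n (B : 'M[F]_n) a :
  eigenvalue B a -> eigenvalue (1%:M - B) (1 - a).
Proof.
move=> /eigenvalueP[v vB v0]; apply/eigenvalueP; exists v => //.
by rewrite mulmxBr mulmx1 vB scalerBl scale1r.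
Qed.

Lemma stationary_iteration_eigenvector (R : realType) n (M N : 'M[R]_n) b
    (x v : 'cV[R]_n) (mu : R) :
  M *m x = N *m x + b -> N *m v = mu *: (M *m v) ->
  stationary_iteration M N b (fun k => x + mu ^+ k *: v).
Proof.
move=> xP vP k.
by rewrite !mulmxDr xP -!scalemxAr vP scalerA -exprSr addrAC.
Qed.

(** At a coordinate where [v] is nonzero, every term stays at distance at least [|v i 0|] from
    [x]. *)
Lemma geometric_not_cvg (R : realType) n (x v : 'cV[R]_n) (mu : R) :
  1 <= `|mu| -> v != 0 -> ~ ((fun k : nat => x + mu ^+ k *: v) @ \oo --> x)%classic.
Proof.
move=> mu_ge1 v_neq0 xcvg.
have /cV0Pn[i vi] := v_neq0.
have {xcvg} : ((fun k : nat => (x + mu ^+ k *: v) i 0) @ \oo --> x i 0)%classic.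
  exact: (cvg_comp _ _ xcvg (@coord_continuous _ _ _ i 0 x)).
have vi_gt0 : 0 < `|v i 0| by rewrite normr_gt0.
move=> /cvgr_dist_lt/(_ _ vi_gt0)[k _ /(_ k (leqnn k))] /=.
rewrite !mxE opprD addNKr normrN normrM normrX ltNge ler_peMl //.
by rewrite exprn_ege1.
Qed.

Theorem mainTheorem1 (R : realType) (n : nat) (A M : 'M[R]_n)
    (hAsym : A^T = A) (hMsym : M^T = M)
    (hAinv : A \in unitmx) (hMinv : M \in unitmx)
    (hinertia : inertia A <> inertia M) :
  (exists2 lambda : R, lambda < 0 & eigenvalue (invmx M *m A) lambda) /\
  ~ contractive M (M - A) /\
  (forall b : 'cV[R]_n, ~ convergent_to_solution M (M - A) b).
Proof.
have [lambda lt0 lambdaP] :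
    exists2 lambda : R, lambda < 0 & eigenvalue (invmx M *m A) lambda.
  apply: contra_notP hinertia => noneg.
  apply: inertia_eq_no_neg_eigenvalue => // x x_lt0.
  by apply/negP => Bx; apply: noneg; exists x.
split; first by exists lambda.
split.
  move=> /(_ (real_complex R (1 - lambda))).
  rewrite mulmxBr mulVmx // eigenvalue_map eigenvalue1B // => /(_ isT).
  rewrite normc_def -[X in _ < X](rmorph1 (real_complex R)) ltcR /=.
  by rewrite expr0n addr0 sqrtr_sqr ltr_norml; lra.
move=> b cvgP.
have : eigenvalue (invmx M *m A)^T lambda by rewrite eigenvalue_tr.
move=> /eigenvalueP[w wP w_neq0].
have vP : A *m w^T = lambda *: (M *m w^T).
  apply: (can_inj (mulKmx (_ : invmx M \in unitmx))); first by rewrite unitmx_inv.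
  rewrite -scalemxAr mulmxA mulKmx //; apply: trmx_inj.
  by rewrite trmx_mul trmxK wP linearZ /= trmxK.
(* As [M - (M - A) = A], this is the solution of the system and a fixed point of the iteration. *)
pose x := invmx (M - (M - A)) *m b.
apply: (@geometric_not_cvg _ _ x w^T (1 - lambda)); last 1 first.
- apply: cvgP; apply: stationary_iteration_eigenvector.
    apply/eqP; rewrite -subr_eq0 opprD addrA -mulmxBl /x mulmxA mulmxV ?mul1mx ?subrr //.
    by rewrite opprB addrC subrK.
  by rewrite mulmxBl vP scalerBl scale1r.
- by rewrite ger0_norm; lra.
- by rewrite -trmx0 (inj_eq trmx_inj).
Qed.
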